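(* Let $\mathbf{s}_{k-1},\mathbf{y}_{k-1}\in\mathbb{R}^n$ satisfy $\mathbf{s}_{k-1}^{T}\mathbf{y}_{k-1}>0$, and let $m_k\in(0,1]$. Let $\alpha_k^{PBB}=\alpha_k^{PBB}(m_k)$, $\alpha_k^{BB1}$ and $\alpha_k^{BB2}$ be the scalars defined in the context. Then $\alpha_k^{PBB}$ is monotonically decreasing with respect to $m_k\in(0,1]$, and $$\alpha_k^{PBB}\in[\alpha_k^{BB1},\alpha_k^{BB2}).$$
   Context: For vectors $\mathbf{s}_{k-1},\mathbf{y}_{k-1}\in\mathbb{R}^n$ with $\mathbf{s}_{k-1}^{T}\mathbf{y}_{k-1}>0$ (in the paper, $\mathbf{s}_{k-1}=\mathbf{x}_k-\mathbf{x}_{k-1}$ is a difference of iterates and $\mathbf{y}_{k-1}=\mathbf{g}_k-\mathbf{g}_{k-1}$ the corresponding difference of gradients), the two Barzilai-Borwein scalars are $$\alpha_k^{BB1}=\frac{\mathbf{s}_{k-1}^{T}\mathbf{y}_{k-1}}{\mathbf{s}_{k-1}^{T}\mathbf{s}_{k-1}},\qquad \alpha_k^{BB2}=\frac{\mathbf{y}_{k-1}^{T}\mathbf{y}_{k-1}}{\mathbf{s}_{k-1}^{T}\mathbf{y}_{k-1}}.$$ For $m_k\in(0,1]$ the parameterized Barzilai-Borwein scalar is $$\alpha_k^{PBB}=\frac{(2m_k-1)\mathbf{s}_{k-1}^{T}\mathbf{y}_{k-1}+\sqrt{\big((2m_k-1)\mathbf{s}_{k-1}^{T}\mathbf{y}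_{k-1}\big)^2-4m_k(m_k-1)\,\mathbf{s}_{k-1}^{T}\mathbf{s}_{k-1}\,\mathbf{y}_{k-1}^{T}\mathbf{y}_{k-1}}}{2m_k\,\mathbf{s}_{k-1}^{T}\mathbf{s}_{k-1}}.$$
   Formalization: If y is a multiple of s, the two BB scalars and the PBB scalar coincide, so the half-open interval is empty; the strict upper bound and strict decrease are claimed only for s, y not parallel, with the closed interval and non-strict decrease in general. *)

(* Defs.v *)
From HB Require Import structures.
From mathcomp Require Import all_boot all_order all_algebra.
From mathcomp Require Import reals.

Set Implicit Arguments.
Unset Strict Implicit.
Unset Printing Implicit Defensive.

Import Order.TTheory GRing.Theory Num.Theory.
Local Open Scope ring_scope.

Definition dot (R : realType) (n : nat) (u v : 'cV[R]_n) : R :=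
  (u^T *m v) 0 0.

Definition alphaBB1 (R : realType) (n : nat) (s y : 'cV[R]_n) : R :=
  dot s y / dot s s.

Definition alphaBB2 (R : realType) (n : nat) (s y : 'cV[R]_n) : R :=
  dot y y / dot s y.

(* The larger root of
   m (s^T s) a ^+ 2 - (2 m - 1) (s^T y) a + (m - 1) (y^T y) = 0,
   meaningful for m in ]0, 1]. *)
Definition alphaPBB (R : realType) (n : nat) (s y : 'cV[R]_n) (m : R) : R :=
  ((2 * m - 1) * dot s y
     + Num.sqrt (((2 * m - 1) * dot s y) ^+ 2
                   - 4 * m * (m - 1) * dot s s * dot y y))
  / (2 * m * dot s s).

(* When y = c *: s with c > 0 and s != 0, alphaBB1 = alphaBB2 and alphaPBB is
   constant in m, so `[alphaBB1, alphaBB2[ is empty. *)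
Definition not_parallel (R : realType) (n : nat) (s y : 'cV[R]_n) : Prop :=
  forall c : R, y <> c *: s.

(* Main.v *)
(* Write a = s^T s, b = s^T y, c = y^T y. For m in ]0, 1] the scalar alphaPBB
   is positive and solves m x (a x - b) = (1 - m) (c - b x). By Cauchy-Schwarz
   b / a <= c / b, so comparing signs of the two sides forces x to lie in
   [b / a, c / b]. On this interval the left side is nonnegative and increasing
   in both x and m, the right side is nonnegative and decreasing in both, so
   the solution x decreases with m. *)
Require Import Defs.
From HB Require Import structures.
From mathcomp Require Import all_boot all_order all_algebra.
From mathcomp Require Import reals.
From mathcomp Require Import ring lra.

Set Implicit Arguments.
Unset Strict Implicit.
Unset Printing Implicit Defensive.

Import Order.TTheory GRing.Theory Num.Theory.
Local Open Scope ring_scope.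

Section DotProduct.
Variables (R : realType) (n : nat).
Implicit Types (k : R) (u v s y : 'cV[R]_n).

Lemma dotE u v : dot u v = \sum_i u i 0 * v i 0.
Proof. by rewrite /dot mxE; apply: eq_bigr => i _; rewrite mxE. Qed.

Lemma dot_ge0 u : 0 <= dot u u.
Proof. by rewrite dotE; apply: sumr_ge0 => i _; exact: sqr_ge0. Qed.

Lemma dot_eq0 u : (dot u u == 0) = (u == 0).
Proof.
apply/eqP/eqP => [|->]; last by rewrite /dot mulmx0 mxE.
rewrite dotE => /psumr_eq0P u0; apply/colP => i; rewrite mxE.
by apply/eqP; rewrite -sqrf_eq0 expr2 u0 // => j _; exact: sqr_ge0.
Qed.

Lemma dot_self_gt0 s y : 0 < dot s y -> 0 < dot s s.
Proof.
rewrite [0 < dot s s]lt_neqAle dot_ge0 andbT eq_sym dot_eq0 => sy_gt0.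
by apply: contraTneq sy_gt0 => ->; rewrite /dot trmx0 mul0mx mxE ltxx.
Qed.

Lemma dot_subZ k u v :
  dot (v - k *: u) (v - k *: u)
  = dot v v - 2 * k * dot u v + k ^+ 2 * dot u u.
Proof.
rewrite !dotE !mulr_sumr -sumrB -big_split /=.
by apply: eq_bigr => i _; rewrite !mxE; ring.
Qed.

(** Here [k *: s] is the orthogonal projection of [y] on [s], so the defect in Cauchy-Schwarz is a
    multiple of a squared norm, which yields both the weak and the strict inequality. *)
Lemma dot_proj_residual s y (k := dot s y / dot s s) : dot s s != 0 ->
  dot s s * dot (y - k *: s) (y - k *: s)
  = dot s s * dot y y - dot s y ^+ 2.
Proof. by move=> s0; rewrite dot_subZ /k; field. Qed.

Lemma cauchy_schwarz s y : 0 < dot s s -> dot s y ^+ 2 <= dot s s * dot y y.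
Proof.
move=> s_gt0; rewrite -subr_ge0 -dot_proj_residual ?gt_eqF//.
by rewrite mulr_ge0 ?dot_ge0.
Qed.

Lemma cauchy_schwarz_strict s y : 0 < dot s s -> not_parallel s y ->
  dot s y ^+ 2 < dot s s * dot y y.
Proof.
move=> s_gt0 npar; rewrite -subr_gt0 -dot_proj_residual ?gt_eqF//.
rewrite mulr_gt0// lt_neqAle dot_ge0 andbT eq_sym dot_eq0 subr_eq0.
exact/eqP/npar.
Qed.

End DotProduct.

Section BalanceEquation.
Variable R : realFieldType.
Implicit Types a b c m x : R.

(** The quadratic is split into two sides whose signs can be read off separately. Positivity of [x]
    singles out the larger root, since the product of the roots is [(m - 1) * c / (m * a)]. *)
Definition pbb_root a b c m x :=
  0 < x /\ m * (x * (a * x - b)) = (1 - m) * (c - b * x).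

(** If [a * x < b], then [a * (b * x) < b ^+ 2 <= a * c]: the right side of the balance is
    nonnegative and the left one negative. *)
Lemma pbb_root_lower a b c m x : 0 < a -> 0 < b -> b ^+ 2 <= a * c ->
  0 < m <= 1 -> pbb_root a b c m x -> b <= a * x.
Proof.
move=> a_gt0 b_gt0 cs /andP[m_gt0 m_le1] [x_gt0 eqx].
rewrite leNgt; apply/negP => ltax.
have ltabx : a * (b * x) < a * c.
  by apply: lt_le_trans cs; rewrite mulrCA expr2 ltr_pM2l.
have : 0 <= (1 - m) * (c - b * x).
  by rewrite mulr_ge0 ?subr_ge0// -(ler_pM2l a_gt0) ltW.
by rewrite -eqx leNgt pmulr_rlt0// pmulr_rlt0// subr_lt0 ltax.
Qed.

Lemma pbb_root_le a b c m x : 0 < a -> 0 < b ->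
  0 < m <= 1 -> pbb_root a b c m x -> c <= b * x -> a * x <= b.
Proof.
move=> a_gt0 b_gt0 /andP[m_gt0 m_le1] [x_gt0 eqx] lecx.
have : (1 - m) * (c - b * x) <= 0 by rewrite mulr_ge0_le0 ?subr_ge0 ?subr_le0.
by rewrite -eqx pmulr_rle0// pmulr_rle0// subr_le0.
Qed.

(** Were [c < b * x], the balance would force [a * x <= b], hence [a * c < b * (a * x) <= b ^+ 2],
    against Cauchy-Schwarz. *)
Lemma pbb_root_upper a b c m x : 0 < a -> 0 < b -> b ^+ 2 <= a * c ->
  0 < m <= 1 -> pbb_root a b c m x -> b * x <= c.
Proof.
move=> a_gt0 b_gt0 cs hm hx; rewrite leNgt; apply/negP => ltcx.
have leax := pbb_root_le a_gt0 b_gt0 hm hx (ltW ltcx).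
rewrite -(ltr_pM2l a_gt0) in ltcx; have := le_lt_trans cs ltcx.
by rewrite mulrCA expr2 ltr_pM2l// ltNge leax.
Qed.

Lemma pbb_root_upper_strict a b c m x : 0 < a -> 0 < b -> b ^+ 2 < a * c ->
  0 < m <= 1 -> pbb_root a b c m x -> b * x < c.
Proof.
move=> a_gt0 b_gt0 cs hm hx; rewrite ltNge; apply/negP => lecx.
have leax := pbb_root_le a_gt0 b_gt0 hm hx lecx.
rewrite -(ler_pM2l a_gt0) in lecx; have := lt_le_trans cs lecx.
by rewrite mulrCA expr2 ltr_pM2l// ltNge leax.
Qed.

Lemma pbb_root_anti a b c m1 m2 x1 x2 : 0 < a -> 0 < b -> b ^+ 2 <= a * c ->
  0 < m1 <= 1 -> 0 < m2 <= 1 -> pbb_root a b c m1 x1 -> pbb_root a b c m2 x2 ->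
  m1 <= m2 -> x2 <= x1.
Proof.
move=> a_gt0 b_gt0 cs hm1 hm2 hx1 hx2 le_m; rewrite leNgt; apply/negP => lt_x.
have lo1 := pbb_root_lower a_gt0 b_gt0 cs hm1 hx1.
have up2 := pbb_root_upper a_gt0 b_gt0 cs hm2 hx2.
case: hx1 hx2 => [x1_gt0 eq1] [x2_gt0 eq2].
case/andP: hm1 hm2 => m1_gt0 m1_le1 /andP[m2_gt0 m2_le1].
have lt_ax : a * x1 < a * x2 by rewrite ltr_pM2l.
have lt_bx : b * x1 < b * x2 by rewrite ltr_pM2l.
have : (1 - m2) * (c - b * x2) <= (1 - m1) * (c - b * x1).
  by apply: ler_pM; rewrite ?subr_ge0//; lra.
apply/negP; rewrite -ltNge -eq1 -eq2.
(* The left side is raised in two moves: first in [m] with [x1] fixed, then strictly in [x] with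
   [m2] fixed. *)
apply: (@le_lt_trans _ _ (m2 * (x1 * (a * x1 - b)))).
  by rewrite ler_wpM2r// mulr_ge0 ?subr_ge0// ltW.
by rewrite ltr_pM2l// ltr_pM ?subr_ge0 ?ltrD2r// ltW.
Qed.

(** Only a common root remains to be excluded. There [c - b * x1] is positive, so raising [m]
    strictly lowers the right side but never the left one. *)
Lemma pbb_root_anti_strict a b c m1 m2 x1 x2 : 0 < a -> 0 < b ->
  b ^+ 2 < a * c -> 0 < m1 <= 1 -> 0 < m2 <= 1 ->
  pbb_root a b c m1 x1 -> pbb_root a b c m2 x2 -> m1 < m2 -> x2 < x1.
Proof.
move=> a_gt0 b_gt0 cs hm1 hm2 hx1 hx2 lt_m.
have le_x := pbb_root_anti a_gt0 b_gt0 (ltW cs) hm1 hm2 hx1 hx2 (ltW lt_m).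
rewrite lt_neqAle le_x andbT; apply/eqP => eq_x.
have lo1 := pbb_root_lower a_gt0 b_gt0 (ltW cs) hm1 hx1.
have up1 := pbb_root_upper_strict a_gt0 b_gt0 cs hm1 hx1.
case: hx1 hx2 => [x1_gt0 eq1] [_]; rewrite eq_x => eq2.
have : (1 - m2) * (c - b * x1) < (1 - m1) * (c - b * x1).
  by rewrite ltr_pM2r ?subr_gt0// ltrD2l ltrN2.
apply/negP; rewrite -leNgt -eq1 -eq2.
rewrite ler_wpM2r ?(ltW lt_m)//.
by rewrite mulr_ge0 ?subr_ge0// ltW.
Qed.

End BalanceEquation.

Lemma alphaPBB_root (R : realType) (n : nat) (s y : 'cV[R]_n) (m : R) :
  0 < dot s y -> 0 < m <= 1 ->
  pbb_root (dot s s) (dot s y) (dot y y) m (alphaPBB s y m).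
Proof.
move=> b_gt0 /andP[m_gt0 m_le1]; have a_gt0 := dot_self_gt0 b_gt0.
have cs := cauchy_schwarz y a_gt0; rewrite /alphaPBB.
(* From here on only three real numbers matter. *)
move: (dot s s) (dot s y) (dot y y) a_gt0 b_gt0 cs => a b c a_gt0 b_gt0 cs.
set p := (2 * m - 1) * b; set D := _ - _; set r := Num.sqrt D.
have ac_gt0 : 0 < a * c by apply: lt_le_trans cs; rewrite exprn_gt0.
(* The gap [D - p ^+ 2] equals [4 * m * (1 - m) * (a * c)]. *)
have leD : p ^+ 2 <= D.
  have: 0 <= m * (1 - m) * (a * c).
    by apply: mulr_ge0 (ltW ac_gt0); rewrite mulr_ge0 ?subr_ge0// ltW.
  by rewrite /D; lra.
have r2 : r ^+ 2 = D by rewrite sqr_sqrtr// (le_trans _ leD)// sqr_ge0.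
have r_ge0 : 0 <= r by exact: sqrtr_ge0.
have pr_gt0 : 0 < p + r.
  (* If [p <= 0], then [m] is at most one half, so the gap is strict and [r] exceeds [- p]. *)
  have [p_gt0|p_le0] := ltP 0 p; first exact: ltr_wpDr.
  have m_lt1 : m < 1.
    by move: p_le0; rewrite /p pmulr_lle0//; lra.
  have ltD : p ^+ 2 < D.
    have: 0 < m * (1 - m) * (a * c).
      by apply: mulr_gt0 ac_gt0; rewrite mulr_gt0 ?subr_gt0.
    by rewrite /D; lra.
  rewrite addrC -[p]opprK subr_gt0 -(@ltr_pXn2r _ 2)// ?nnegrE ?oppr_ge0//.
  by rewrite sqrrN r2.
split; first by rewrite divr_gt0// !mulr_gt0.
have a0 : a != 0 by rewrite gt_eqF.
have m0 : m != 0 by rewrite gt_eqF.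
apply/eqP; rewrite -subr_eq0; apply/eqP.
(* Substituting [(p + r) / (2 * m * a)] turns the difference of the two sides into this quotient. *)
transitivity ((r ^+ 2 - D) / (4 * m * a)); last by rewrite r2 subrr mul0r.
by rewrite /D /p; field; rewrite m0 a0.
Qed.

Theorem theorem1 (R : realType) (n : nat) (s y : 'cV[R]_n)
    (hsy : 0 < dot s y) :
  [/\ (forall m1 m2 : R, m1 \in `]0, 1] -> m2 \in `]0, 1] -> m1 <= m2 ->
         alphaPBB s y m2 <= alphaPBB s y m1),
      (forall m : R, m \in `]0, 1] ->
         alphaPBB s y m \in `[alphaBB1 s y, alphaBB2 s y])
    & not_parallel s y ->
      (forall m1 m2 : R, m1 \in `]0, 1] -> m2 \in `]0, 1] -> m1 < m2 ->
         alphaPBB s y m2 < alphaPBB s y m1) /\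
      (forall m : R, m \in `]0, 1] ->
         alphaPBB s y m \in `[alphaBB1 s y, alphaBB2 s y[)].
Proof.
have hss := dot_self_gt0 hsy; have cs := cauchy_schwarz y hss.
have lower m : 0 < m <= 1 -> alphaBB1 s y <= alphaPBB s y m.
  move=> hm; rewrite /alphaBB1 ler_pdivrMr// mulrC.
  exact: (pbb_root_lower hss hsy cs hm (alphaPBB_root hsy hm)).
split=> [m1 m2|m|npar].
- rewrite !in_itv /= => hm1 hm2.
  exact: (pbb_root_anti hss hsy cs hm1 hm2 (alphaPBB_root hsy hm1)
                                           (alphaPBB_root hsy hm2)).
- rewrite !in_itv /= => hm; rewrite lower//= /alphaBB2 ler_pdivlMr// mulrC.
  exact: (pbb_root_upper hss hsy cs hm (alphaPBB_root hsy hm)).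
(* Non-parallelism enters only through strict Cauchy-Schwarz, which makes both the monotonicity and
   the upper bound strict. *)
have css := cauchy_schwarz_strict hss npar.
split=> [m1 m2|m]; rewrite !in_itv /=.
  move=> hm1 hm2.
  exact: (pbb_root_anti_strict hss hsy css hm1 hm2 (alphaPBB_root hsy hm1)
                                                   (alphaPBB_root hsy hm2)).
move=> hm; rewrite lower//= /alphaBB2 ltr_pdivlMr// mulrC.
exact: (pbb_root_upper_strict hss hsy css hm (alphaPBB_root hsy hm)).
Qed.
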